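(* Let $d\ge 2$ and consider Hamiltonians (Hermitian operators) $H$ on $\mathbb{C}^d$ with fixed orthonormal (incoherent) basis $\{\ket{i}\}_{i=0}^{d-1}$. Then \[ \max_{\|H\|_{2}\leq 1} C_{\mathrm{gen}}(H)=\max_{\boldsymbol{p}}\sqrt{2f(\boldsymbol{p})}, \] where the maximum on the left is over all Hamiltonians on $\mathbb{C}^d$ with Hilbert–Schmidt norm $\|H\|_2=\sqrt{\mathrm{Tr}[H^\dagger H]}\le 1$, and the maximum on the right is over all probability distributions $\boldsymbol{p}=(p_0,\ldots,p_{d-1})$ on $d$ outcomes.
   Context: The dephasing map is $\Delta(\rho)=\sum_{i}\ket{i}\!\bra{i}\rho\ket{i}\!\bra{i}$. The relative entropy of coherence of a state $\rho$ is $C_\mathrm{r}(\rho)=S(\Delta(\rho))-S(\rho)$, where $S(\rho)=-\mathrm{Tr}[\rho\log_2\rho]$. The coherence generating capacity of a Hamiltonian $H$ is \[ C_{\mathrm{gen}}(H)=\max_{\rho}\left.\frac{d}{dt}C_{\mathrm{r}}\big(e^{-iHt}\rho e^{iHt}\big)\right|_{t=0}, \] the maximum over all density matrices $\rho$ on $\mathbb{C}^d$. For a probability distribution $\boldsymbol{p}$, $f(\boldsymbol{p})$ is the variance of the surprisal: \[ f(\boldsymbol{p})=\sum_{i}p_{i}\left(-\log_{2}p_{i}\right)^{2}-\Big[\sum_{i}p_{i}\left(-\log_{2}p_{i}\right)\Big]^{2} \] (with the convention $0\log_2 0=0$, $0(\log_2 0)^2=0$). *)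

(* Defs.v *)
From HB Require Import structures.
From mathcomp Require Import all_boot all_order all_algebra.
From mathcomp Require Import sesquilinear spectral.
From mathcomp Require Import complex.
From mathcomp Require Import reals topology normedtype exp trigo derive.
Import numFieldNormedType.Exports.
Set Implicit Arguments. Unset Strict Implicit. Unset Printing Implicit Defensive.
Import Order.TTheory GRing.Theory Num.Theory.
Local Open Scope ring_scope.
Local Open Scope sesquilinear_scope.

Section QDefs.
Variable R : realType.
Local Notation C := (R[i]).

Definition adjmx m n (A : 'M[C]_(m, n)) : 'M[C]_(n, m) := A ^t*.

Definition is_hermitian n (H : 'M[C]_n) : Prop := adjmx H = H.

Definition hs_norm n (H : 'M[C]_n) : R :=
  Num.sqrt (complex.Re (\tr (adjmx H *m H))).

Definition density n (rho : 'M[C]_n) : Prop :=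
  [/\ is_hermitian rho,
      (forall v : 'cV[C]_n, 0 <= (adjmx v *m rho *m v) 0 0)
    & \tr rho = 1].

Definition log2 (x : R) : R := ln x / ln 2.

Definition eta2 (x : R) : R := if x == 0 then 0 else - (x * log2 x).

(* continuous functional calculus for normal (in particular Hermitian)
   matrices, via the spectral decomposition A = P^-1 diag(sp) P, P unitary *)
Definition mxfun n (f : C -> C) (A : 'M[C]_n) : 'M[C]_n :=
  invmx (spectralmx A) *m diag_mx (map_mx f (spectral_diag A)) *m spectralmx A.

Definition vN_entropy n (rho : 'M[C]_n) : R :=
  \sum_(k < n) eta2 (complex.Re (spectral_diag rho 0 k)).

Definition dephase n (rho : 'M[C]_n) : 'M[C]_n :=
  \matrix_(i, j) if i == j then rho i j else 0.

Definition Crel n (rho : 'M[C]_n) : R :=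
  vN_entropy (dephase rho) - vN_entropy rho.

Definition expiC (theta : R) : C := Complex (cos theta) (sin theta).

Definition evolve n (H : 'M[C]_n) (t : R) (rho : 'M[C]_n) : 'M[C]_n :=
  mxfun (fun l => expiC (- (complex.Re l * t))) H *m rho
    *m mxfun (fun l => expiC (complex.Re l * t)) H.

Definition coh_rate n (H rho : 'M[C]_n) : R :=
  derive1 (fun t : R => Crel (evolve H t rho)) 0.

Definition Cgen_is n (H : 'M[C]_n) (c : R) : Prop :=
  (exists2 rho : 'M[C]_n, density rho & coh_rate H rho = c) /\
  (forall rho : 'M[C]_n, density rho -> coh_rate H rho <= c).

Definition prob_dist n (p : 'I_n -> R) : Prop :=
  (forall i, 0 <= p i) /\ \sum_(i < n) p i = 1.

Definition sq_term (x : R) : R := if x == 0 then 0 else x * (log2 x) ^+ 2.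

(* variance of the surprisal *)
Definition fsurp n (p : 'I_n -> R) : R :=
  \sum_(i < n) sq_term (p i) - (\sum_(i < n) eta2 (p i)) ^+ 2.

End QDefs.

(* Main.v *)
(** Along the evolution the spectrum of rho, hence S(rho), is constant, so only
    the entropy of the diagonal p = diag(rho) moves, and with L_i = log2 p_i
<<
      d/dt C_r = - sum_i L_i Im [H, rho]_ii
               = - sum_ij (L_i - L_j) Im (H_ij rho_ji).
>>
    Where p_i = 0 the logarithmic singularity is harmless: p_i (t) = O(t^2).
    Cauchy-Schwarz and |rho_ij|^2 <= p_i p_j bound the rate by
<<
      ||H||_2 sqrt (sum_ij (L_i - L_j)^2 p_i p_j) = ||H||_2 sqrt (2 f(p)),
>>
    with equality for rho the pure state of amplitudes sqrt p_i and
    H_ij proportional to i (L_j - L_i) sqrt (p_i p_j).  Both maxima (over p, and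
    over rho for a given H) exist by compactness, because sqrt x ln x -> 0 makes
    f(p) and L_i rho_ij continuous up to p_i = 0. *)
Require Import Defs.
From HB Require Import structures.
From mathcomp Require Import all_boot all_order all_algebra.
From mathcomp Require Import sesquilinear spectral complex.
From mathcomp Require Import boolp classical_sets functions reals.
From mathcomp Require Import topology normedtype exp trigo.
From mathcomp Require Import derive realfun function_spaces.
From mathcomp Require Import ring lra.
Import numFieldNormedType.Exports.
Set Implicit Arguments. Unset Strict Implicit. Unset Printing Implicit Defensive.
Import Order.TTheory GRing.Theory Num.Theory.
Local Open Scope classical_set_scope.
Local Open Scope ring_scope.

(** * Entropy near the boundary of the simplex *)

Section Analysis.
Variable R : realType.
Implicit Types (x y : R).

(** For $x \ge 0$, both $x\ln x$ and $x(\ln x)^2$ factor through this function. It is continuous on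
    the whole line, since [Num.sqrt] and [ln] return 0 at nonpositive arguments. *)
Definition sqrt_ln x : R := Num.sqrt x * ln x.

(** With $s = x^{1/4}$ the function is $4 s^2 \ln s$, and $-\ln s = \ln(1/s) \le 1/s$. *)
Lemma norm_sqrt_ln x : x <= 1 -> `|sqrt_ln x| <= 4 * Num.sqrt (Num.sqrt x).
Proof.
move=> x1; have [x0|x0] := leP x 0.
  by rewrite /sqrt_ln ln0// mulr0 normr0 mulr_ge0// sqrtr_ge0.
set s := Num.sqrt (Num.sqrt x).
have s0 : 0 < s by rewrite !sqrtr_gt0.
have s2 : Num.sqrt x = s ^+ 2 by rewrite sqr_sqrtr// sqrtr_ge0.
have s4 : x = s ^+ 4 by rewrite -[4%N]/(2*2)%N exprM -s2 sqr_sqrtr// ltW.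
have lns : - ln s <= s^-1.
  by rewrite -lnV ?posrE//; apply/ltW/ln_sublinear; rewrite invr_gt0.
rewrite /sqrt_ln s2 s4 lnXn// normrM ger0_norm ?sqr_ge0//.
have ls : ln s <= 0.
  rewrite ln_le0// leNgt; apply/negP => s1.
  by move: x1; rewrite s4 leNgt exprn_egt1.
rewrite ler0_norm ?mulrn_wle0// -mulNrn -[X in _ * X]mulr_natl.
have : s ^+ 2 * - ln s <= s.
  apply: le_trans (ler_wpM2l (sqr_ge0 s) lns) _.
  by rewrite expr2 mulfK// gt_eqF.
nra.
Qed.

Lemma continuous_sqrt_ln : continuous sqrt_ln.
Proof.
move=> x; have [x0|x0] := ltP 0 x.
  by apply: cvgM; [exact: sqrt_continuous|exact: continuous_ln].
have sx : sqrt_ln x = 0 by rewrite /sqrt_ln ln0// mulr0.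
rewrite /continuous_at sx.
apply/norm_cvg0P.
apply: (@squeeze_cvgr _ _ _ _ (cst 0) (fun z => 4 * Num.sqrt (Num.sqrt z))).
- near=> z; rewrite /= normr_ge0 /= norm_sqrt_ln// ltW//.
  near: z; apply: lt_nbhsl; lra.
- exact: cvg_cst.
- rewrite [X in _ --> X](_ : _ = 4 * Num.sqrt (Num.sqrt x)); last first.
    by rewrite (ler0_sqrtr x0) sqrtr0 mulr0.
  apply: cvgMr.
  by apply: (@continuous_comp _ _ _ (@Num.sqrt R) (@Num.sqrt R)); exact: sqrt_continuous.
Unshelve. all: by end_near. Qed.

(* [|y| <= sqrt p] makes the limit valid also at [p0 <= 0], where [ln] is
   discontinuous and takes the junk value [0]. *)
Lemma cvg_lnM (T : Type) (F : set_system T) (FF : Filter F) (p y : T -> R) (p0 y0 : R) :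
  p @ F --> p0 -> y @ F --> y0 -> (\near F, `|y F| <= Num.sqrt (p F)) ->
  (fun t => ln (p t) * y t) @ F --> ln p0 * y0.
Proof.
move=> cp cy yp; have [p0_gt0|p0_le0] := ltP 0 p0.
  apply: cvgM => //; apply: continuous_cvg => //; exact: continuous_ln.
rewrite ln0// mul0r; apply/norm_cvg0P.
apply: (@squeeze_cvgr _ _ _ _ (cst 0) (fun t => `|sqrt_ln (p t)|)).
- near=> t; rewrite /= normr_ge0 /= !normrM mulrC ler_wpM2r//.
  by rewrite (ger0_norm (sqrtr_ge0 _)); near: t.
- exact: cvg_cst.
- apply/norm_cvg0P.
  rewrite [X in _ --> X](_ : _ = sqrt_ln p0); last by rewrite /sqrt_ln ln0// mulr0.
  by apply: continuous_cvg => //; exact: continuous_sqrt_ln.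
Unshelve. all: by end_near. Qed.

(** A closed set inside the box $[-M, M]^I$ is compact by Tychonoff. Probability vectors and
    matrices are both treated as functions on an index type so that this applies. *)
Lemma ptws_EVT_max (I : eqType) (K : set {ptws I -> R}) (M : R)
    (f : {ptws I -> R} -> R) :
  K !=set0 -> closed K -> (forall z, K z -> forall i, `|z i| <= M) ->
  {within K, continuous f} ->
  exists2 c, K c & forall z, K z -> f z <= f c.
Proof.
move=> K0 Kcl Kbd fK.
have Kcp : compact K.
  apply: (@subclosed_compact _ K
    [set z : {ptws I -> R} | forall i, `[- M, M]%classic (z i)]) => //.
    apply: (@tychonoff I (fun _ => R) (fun _ => `[- M, M]%classic)) => i.
    exact: segment_compact.
  by move=> z Kz i /=; rewrite in_itv/= -ler_norml; exact: Kbd.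
have [c cK cmax] := compact_EVT_max K0 Kcp fK.
exists c; first by rewrite inE in cK.
by move=> z Kz; apply: cmax; rewrite inE.
Qed.

Lemma ptws_proj_continuous (I : eqType) (i : I) :
  continuous (fun z : {ptws I -> R} => z i).
Proof. exact: (@proj_continuous I (fun=> R) i). Qed.

(** * Derivative of the entropy function along a path *)

Lemma ln2_gt0 : 0 < ln 2 :> R.
Proof. by rewrite ln_gt0// ltr1n. Qed.

Lemma eta2E x : eta2 x = - (x * log2 x).
Proof. by rewrite /eta2; case: eqP => // ->; rewrite mul0r oppr0. Qed.

Lemma sq_termE x : sq_term x = x * log2 x ^+ 2.
Proof. by rewrite /sq_term; case: eqP => // ->; rewrite mul0r. Qed.

Lemma is_derive_eta2 (p : R -> R) (dp : R) :
  is_derive (0:R) 1 p dp -> 0 < p 0 ->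
  is_derive (0:R) 1 (fun t => eta2 (p t)) (- ((log2 (p 0) + (ln 2)^-1) * dp)).
Proof.
move=> Dp p0.
rewrite (_ : (fun t => _) = (fun t => - (p t * log2 (p t)))); last first.
  by apply/funext => t; rewrite eta2E.
have Dln : is_derive (0:R) 1 (@ln R \o p) ((p 0)^-1 * dp).
  have Dl := is_derive1_ln p0.
  exact: is_derive1_comp.
have -> : (fun t => - (p t * log2 (p t))) = - (p * ((ln 2)^-1 \*: (@ln R \o p))).
  by apply/funext => t /=; rewrite /log2 [_ / ln 2]mulrC.
apply: is_derive_eq.
rewrite /log2 /= /GRing.scale /=.
have := @gt_eqF _ _ _ _ ln2_gt0; have := @gt_eqF _ _ _ _ p0.
by move=> /negbT pn /negbT ln; field; apply/andP.
Qed.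

(** Up to the factor $-1/\ln 2$, [eta2 p] is $\sqrt p$ times [sqrt_ln p], and $\sqrt{p(h)} \le
    |h|\sqrt C$. The factor $|h|$ cancels in the difference quotient, leaving a multiple of
    [sqrt_ln (p h)], which tends to 0. *)
Lemma is_derive_eta2_0 (p : R -> R) (C : R) :
  (forall t, 0 <= p t <= C * t ^+ 2) -> is_derive (0:R) 1 (fun t => eta2 (p t)) 0.
Proof.
move=> pC.
have C0 : 0 <= C by have /andP[+ +] := pC 1; rewrite expr1n mulr1; exact: le_trans.
have p00 : p 0 = 0.
  by apply/eqP; rewrite eq_le andbC; have := pC 0; rewrite expr0n mulr0.
have cp : p @ (0:R) --> (0:R).
  apply: (@squeeze_cvgr _ _ _ _ (cst 0) (fun t => C * t ^+ 2)).
  - by near=> t; exact: pC.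
  - exact: cvg_cst.
  - rewrite [X in _ --> X](_ : _ = C * 0 ^+ 2); last by rewrite expr0n mulr0.
    by apply: cvgMr; apply: exprn_continuous.
suff cq : (fun h : R => h^-1 *: (eta2 (p (h *: 1 + 0)) - eta2 (p 0))) @ (0:R)^' --> (0:R).
  apply: DeriveDef; first by apply/cvg_ex; exists 0.
  by apply/cvg_lim => //.
apply/norm_cvg0P.
apply: (@squeeze_cvgr _ _ _ _ (cst 0)
  (fun h => Num.sqrt C / ln 2 * `|sqrt_ln (p h)|)).
- near=> h.
  have h0 : h != 0 by near: h; exact: nbhs_dnbhs_neq.
  rewrite /= normr_ge0 /= p00 eta2E (_ : eta2 0 = 0) ?eta2E ?mul0r ?oppr0//.
  rewrite !addr0 /GRing.scale /= mulr1 normrM normrN normfV.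
  rewrite ler_pdivrMl ?normr_gt0//.
  have [/= p0 pCh] := andP (pC h).
  have -> : p h * log2 (p h) = Num.sqrt (p h) * (sqrt_ln (p h) / ln 2).
    by rewrite /sqrt_ln /log2 -{1}(sqr_sqrtr p0); ring.
  move: (sqrt_ln (p h)) => q.
  rewrite !normrM (ger0_norm (sqrtr_ge0 _)) normfV (gtr0_norm ln2_gt0).
  have sp : Num.sqrt (p h) <= `|h| * Num.sqrt C.
    by rewrite -sqrtr_sqr -sqrtrM ?sqr_ge0// ler_wsqrtr// mulrC.
  apply: le_trans (_ : (`|h| * Num.sqrt C) * (`|q| / ln 2) <= _).
    by rewrite ler_wpM2r// mulr_ge0// invr_ge0 ltW// ln2_gt0.
  by rewrite le_eqVlt; apply/orP; left; apply/eqP; ring.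
- exact: cvg_cst.
- rewrite [X in _ --> X](_ : _ = Num.sqrt C / ln 2 * 0); last by rewrite mulr0.
  apply: cvgMr; apply/norm_cvg0P.
  rewrite [X in _ --> X](_ : _ = sqrt_ln 0); last by rewrite /sqrt_ln ln0// mulr0.
  apply: (@cvg_comp _ _ _ p sqrt_ln _ (nbhs (0:R))).
    by apply: cvg_trans cp; apply: cvg_app; exact: nbhs_dnbhs.
  exact: continuous_sqrt_ln.
Unshelve. all: by end_near. Qed.

End Analysis.

(** * Unitary evolution *)

Lemma char_poly_similar (K : comNzRingType) n (U V A : 'M[K]_n) :
  V *m U = 1%:M -> char_poly (U *m A *m V) = char_poly A.
Proof.
move=> VU; have UV : U *m V = 1%:M by exact: mulmx1C.
have VUP : map_mx polyC V *m map_mx polyC U = 1%:M.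
  by rewrite -map_mxM VU map_mx1.
have UVP : map_mx polyC U *m map_mx polyC V = 1%:M.
  by rewrite -map_mxM UV map_mx1.
rewrite /char_poly.
have -> : char_poly_mx (U *m A *m V) =
    map_mx polyC U *m char_poly_mx A *m map_mx polyC V.
  rewrite /char_poly_mx mulmxBr mulmxBl !map_mxM; congr (_ - _).
  by rewrite scalar_mxC -mulmxA UVP mulmx1.
by rewrite !det_mulmx mulrC mulrA -det_mulmx VUP det1 mul1r.
Qed.

Section Quantum.
Variable R : realType.
Local Notation C := (R[i]).
Local Notation Re := (@complex.Re R).
Local Notation Im := (@complex.Im R).

(** * Complex arithmetic, adjoints and Hermitian matrices *)

Lemma Re_sum (I : Type) (r : seq I) (P : pred I) (F : I -> C) :
  Re (\sum_(i <- r | P i) F i) = \sum_(i <- r | P i) Re (F i).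
Proof. exact: (raddf_sum (Re : Rcomplex R -> R)). Qed.

Lemma Im_sum (I : Type) (r : seq I) (P : pred I) (F : I -> C) :
  Im (\sum_(i <- r | P i) F i) = \sum_(i <- r | P i) Im (F i).
Proof. exact: (raddf_sum (Im : Rcomplex R -> R)). Qed.

Lemma Re_mul (a b : C) : Re (a * b) = Re a * Re b - Im a * Im b.
Proof. by case: a b => [a1 a2] [b1 b2]. Qed.

Lemma Im_mul (a b : C) : Im (a * b) = Re a * Im b + Im a * Re b.
Proof. by case: a b => [a1 a2] [b1 b2]. Qed.

Lemma Im_sub (a b : C) : Im (a - b) = Im a - Im b.
Proof. by case: a b => [a1 a2] [b1 b2]. Qed.

Lemma adjmxE m n (A : 'M[C]_(m, n)) i j : adjmx A i j = conjc (A j i).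
Proof. by rewrite /adjmx !mxE. Qed.

Lemma adjmxM m n p (A : 'M[C]_(m, n)) (B : 'M[C]_(n, p)) :
  adjmx (A *m B) = adjmx B *m adjmx A.
Proof. by rewrite /adjmx trmx_mul map_mxM. Qed.

Lemma adjmxK m n (A : 'M[C]_(m, n)) : adjmx (adjmx A) = A.
Proof. exact: trmxCK. Qed.

Lemma is_hermitianP n (A : 'M[C]_n) :
  is_hermitian A <-> forall i j, A i j = conjc (A j i).
Proof.
split=> [hA i j|hA]; first by rewrite -{1}hA adjmxE.
by apply/matrixP => i j; rewrite adjmxE -hA.
Qed.

Lemma is_hermitian_hermsymmx n (A : 'M[C]_n) :
  is_hermitian A -> A \is hermitianmx n false Num.conj.
Proof. by move=> hA; apply/is_hermitianmxP; rewrite expr0 scale1r -[LHS]hA. Qed.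

Lemma hermitian_spectral n (A : 'M[C]_n) : is_hermitian A ->
  A = invmx (spectralmx A) *m diag_mx (spectral_diag A) *m spectralmx A.
Proof.
by move=> /is_hermitian_hermsymmx/hermitian_normalmx/orthomx_spectralP.
Qed.

Lemma hermitian_spectral_Re n (A : 'M[C]_n) k : is_hermitian A ->
  spectral_diag A 0 k = (Re (spectral_diag A 0 k))%:C%C.
Proof.
move=> /is_hermitian_hermsymmx/hermitian_spectral_diag_real/mxOverP/(_ 0 k).
by move=> /RRe_real.
Qed.


(** * Entropy as a function of the characteristic polynomial *)

Lemma char_poly_spectral n (A : 'M[C]_n) : is_hermitian A ->
  char_poly A = \prod_(x <- [seq spectral_diag A 0 k | k <- index_enum 'I_n])
                  ('X - x%:P).
Proof.
move=> hA; rewrite {1}(hermitian_spectral hA) char_poly_similar; last first.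
  by rewrite mulmxV// spectral_unit.
rewrite char_poly_trig ?diag_mx_is_trig// big_map; apply: eq_bigr => i _.
by rewrite mxE eqxx mulr1n.
Qed.

(** The order of the entries of [spectral_diag] is not controlled. Two factorizations of one
    polynomial into monic linear factors agree up to permutation, and the entropy is a symmetric
    sum. *)
Lemma vN_entropy_eigenvalues n (A : 'M[C]_n) (s : 'I_n -> C) :
  is_hermitian A -> char_poly A = \prod_k ('X - (s k)%:P) ->
  vN_entropy A = \sum_k eta2 (Re (s k)).
Proof.
move=> hA; rewrite char_poly_spectral// => eqp.
have E : perm_eq [seq spectral_diag A 0 k | k <- index_enum 'I_n]
    [seq s k | k <- index_enum 'I_n].
  by apply: prod_XsubC_eq; rewrite eqp big_map.
rewrite /vN_entropy -(big_map (fun k => spectral_diag A 0 k) xpredT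
  (fun x => eta2 (Re x))) /= (perm_big _ E) big_map//.
Qed.

Lemma vN_entropy_similar n (A B : 'M[C]_n) :
  is_hermitian A -> is_hermitian B -> char_poly A = char_poly B ->
  vN_entropy A = vN_entropy B.
Proof.
move=> hA hB eqAB.
apply: (vN_entropy_eigenvalues (s := fun k => spectral_diag B 0 k) hA).
by rewrite eqAB char_poly_spectral// big_map.
Qed.

Lemma dephase_hermitian n (A : 'M[C]_n) :
  is_hermitian A -> is_hermitian (dephase A).
Proof.
move=> /is_hermitianP hA; apply/is_hermitianP => i j; rewrite !mxE eq_sym.
by case: eqP => _; rewrite -?hA// conjc0.
Qed.

Lemma vN_entropy_dephase n (A : 'M[C]_n) : is_hermitian A ->
  vN_entropy (dephase A) = \sum_i eta2 (Re (A i i)).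
Proof.
move=> hA; apply: vN_entropy_eigenvalues; first exact: dephase_hermitian.
rewrite char_poly_trig; first by apply: eq_bigr => i _; rewrite mxE eqxx.
by apply/is_trig_mxP => i j ij; rewrite mxE -val_eqE ltn_eqF.
Qed.

(** * The propagator and the evolved state *)

Lemma expiCD (x y : R) : expiC (x + y) = expiC x * expiC y.
Proof. by rewrite /expiC cosD sinD; simpc; congr Complex; ring. Qed.

(** For Hermitian $H$ this is $e^{iHt}$, the right factor of the evolution; the left factor is its
    value at $-t$. *)
Definition propagator n (H : 'M[C]_n) (t : R) : 'M[C]_n :=
  mxfun (fun l => expiC (Re l * t)) H.

Lemma evolveE n (H rho : 'M[C]_n) t :
  evolve H t rho = propagator H (- t) *m rho *m propagator H t.
Proof.
rewrite /evolve /propagator.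
have -> : (fun l : C => expiC (- (Re l * t))) = (fun l => expiC (Re l * - t)).
  by apply/funext => l; rewrite mulrN.
by [].
Qed.

Lemma propagatorN n (H : 'M[C]_n) t : propagator H (- t) *m propagator H t = 1%:M.
Proof.
rewrite /propagator /mxfun !mulmxA mulmxK ?spectral_unit//.
rewrite -(mulmxA _ (diag_mx _) (diag_mx _)) mulmx_diag.
rewrite (_ : (\row__ _) = const_mx 1); last first.
  by apply/rowP => j; rewrite !mxE -expiCD mulrN addNr /expiC cos0 sin0.
by rewrite diag_const_mx mulmx1 mulVmx// spectral_unit.
Qed.

Lemma adjmx_diag n (d : 'rV[C]_n) : adjmx (diag_mx d) = diag_mx (map_mx conjc d).
Proof. by rewrite /adjmx tr_diag_mx map_diag_mx. Qed.

Lemma adjmx_propagator n (H : 'M[C]_n) t : adjmx (propagator H t) = propagator H (- t).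
Proof.
have Pu := spectral_unitarymx H.
rewrite /propagator /mxfun; set l := spectral_diag H.
have -> : map_mx (fun x => expiC (Re x * - t)) l =
    map_mx conjc (map_mx (fun x => expiC (Re x * t)) l).
  by apply/rowP => j; rewrite !mxE mulrN /expiC cosN sinN.
move: (map_mx _ l) => d; rewrite -adjmx_diag invmx_unitary// -/(adjmx _).
move: (spectralmx H) (diag_mx d) => P D.
by rewrite (adjmxM (adjmx P *m D)) (adjmxM (adjmx P)) adjmxK mulmxA.
Qed.

Lemma evolve_hermitian n (H rho : 'M[C]_n) t :
  is_hermitian rho -> is_hermitian (evolve H t rho).
Proof.
move=> hr; rewrite /is_hermitian evolveE.
have := adjmx_propagator H t; have := adjmx_propagator H (- t); rewrite opprK.
move: (propagator H t) (propagator H (- t)) => U V UV VU.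
by rewrite (adjmxM (V *m rho)) (adjmxM V) UV VU hr mulmxA.
Qed.

(** The evolution is a similarity, so it preserves the characteristic polynomial and with it the
    entropy of the state; only the diagonal term depends on $t$. *)
Lemma CrelE n (H rho : 'M[C]_n) t : is_hermitian rho ->
  Crel (evolve H t rho) = \sum_i eta2 (Re (evolve H t rho i i)) - vN_entropy rho.
Proof.
move=> hr; have he := evolve_hermitian H t hr.
rewrite /Crel vN_entropy_dephase//; congr (_ - _).
apply: (vN_entropy_similar he hr); rewrite evolveE.
apply: char_poly_similar.
by have := propagatorN H (- t); rewrite opprK.
Qed.

(** The diagonal entry is the quadratic form of [rho] at column [i] of the propagator. *)
Lemma evolve_diag_ge0 n (H rho : 'M[C]_n) t i : density rho ->
  0 <= Re (evolve H t rho i i).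
Proof.
case=> _ rho_ge0 _; have := rho_ge0 (col i (propagator H t)).
suff -> : (adjmx (col i (propagator H t)) *m rho *m col i (propagator H t)) 0 0
    = evolve H t rho i i by rewrite lecE => /andP[].
have -> : adjmx (col i (propagator H t)) = row i (propagator H (- t)).
  by apply/rowP => j; rewrite adjmxE -adjmx_propagator [RHS]mxE adjmxE mxE.
rewrite -row_mul evolveE [LHS]mxE [RHS]mxE; apply: eq_bigr => k _.
by rewrite [row _ _ 0 k]mxE [col _ _ k 0]mxE.
Qed.

(** * The diagonal of the evolved state as a trigonometric polynomial *)

Lemma mulmx_diag_conjE (K : comPzRingType) n (A B M : 'M[K]_n) (c d : 'rV[K]_n) i :
  (A *m (diag_mx c *m M *m diag_mx d) *m B) i i =
  \sum_(ab : 'I_n * 'I_n)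
    A i ab.1 * M ab.1 ab.2 * B ab.2 i * (c 0 ab.1 * d 0 ab.2).
Proof.
rewrite mul_diag_mx mul_mx_diag mxE.
rewrite -(pair_bigA _ (fun a b => A i a * M a b * B b i * (c 0 a * d 0 b))) /=.
rewrite exchange_big /=; apply: eq_bigr => b _; rewrite mxE big_distrl.
by apply: eq_bigr => a _ /=; rewrite !mxE; ring.
Qed.

(** Coefficient of the pair $(a,b)$ of eigenvectors in the expansion of diagonal entry [i] as a
    trigonometric polynomial in $t$; [spectral_gap] gives the matching frequency $\lambda_b -
    \lambda_a$. *)
Definition spectral_weight n (H rho : 'M[C]_n) i (ab : 'I_n * 'I_n) : C :=
  invmx (spectralmx H) i ab.1 *
  (spectralmx H *m rho *m invmx (spectralmx H)) ab.1 ab.2 *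
  spectralmx H ab.2 i.

Definition spectral_gap n (H : 'M[C]_n) (ab : 'I_n * 'I_n) : R :=
  Re (spectral_diag H 0 ab.2) - Re (spectral_diag H 0 ab.1).

Lemma evolve_diagE n (H rho : 'M[C]_n) t i :
  evolve H t rho i i =
  \sum_ab spectral_weight H rho i ab * expiC (spectral_gap H ab * t).
Proof.
rewrite /evolve /mxfun; set P := spectralmx H; set l := spectral_diag H.
set D1 := diag_mx _; set D2 := diag_mx _.
have -> : invmx P *m D1 *m P *m rho *m (invmx P *m D2 *m P) =
    invmx P *m (D1 *m (P *m rho *m invmx P) *m D2) *m P by rewrite !mulmxA.
rewrite mulmx_diag_conjE; apply: eq_bigr => -[a b] _.
rewrite /spectral_weight /spectral_gap -/P -/l; congr (_ * _).
clear D1 D2; by move: l => l /=; rewrite !mxE -expiCD; congr expiC; ring.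
Qed.

Lemma le_norm_sin (x : R) : `|sin x| <= `|x|.
Proof.
wlog x0 : x / 0 <= x => [H|].
  have [|x0] := leP 0 x; first exact: H.
  by rewrite -normrN -sinN -[leRHS]normrN H// oppr_ge0 ltW.
have dsin (y : R) : y \in `]0, x[%R -> is_derive y 1 (@sin R) (cos y).
  by move=> _; exact: is_derive_sin.
have csin : {within `[0, x], continuous (@sin R)}.
  by apply: continuous_subspaceT; exact: continuous_sin.
have [c _] := MVT_segment x0 dsin csin.
rewrite sin0 !subr0 => ->; rewrite normrM ler_piMl//; exact: cos_max.
Qed.

Lemma le_oneB_cos (x : R) : 0 <= 1 - cos x <= x ^+ 2.
Proof.
rewrite subr_ge0 cos_le1 /= {1}(splitr x) -mulr2n cos_mulr2n cos2sin2.
have := le_norm_sin (x / 2); rewrite -ler_sqr ?nnegrE// !real_normK ?num_real//.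
nra.
Qed.

(* Bound [p t] by [p t + p (- t)], in which the sines cancel. *)
Lemma trig_sum_bound (I : finType) (x y w : I -> R) (p : R -> R) :
  (forall t, p t = \sum_i (x i * cos (w i * t) - y i * sin (w i * t))) ->
  (forall t, 0 <= p t) -> p 0 = 0 ->
  exists B, forall t, 0 <= p t <= B * t ^+ 2.
Proof.
move=> pE p_ge0 p0.
have SE t : p t + p (- t) = \sum_i (2 * x i) * (cos (w i * t) - 1).
  (* Subtracting $2p(0) = 0$ turns each cosine into $\cos(\omega t) - 1$, which is of order
     $t^2$. *)
  have -> : p t + p (- t) = p t + p (- t) - (p 0 + p 0) by rewrite p0 addr0 subr0.
  rewrite !pE.
  rewrite -!big_split -sumrB; apply: eq_bigr => i _ /=.
  by rewrite mulrN cosN sinN !mulr0 cos0 sin0; ring.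
exists (\sum_i (2 * `|x i|) * w i ^+ 2) => t; rewrite p_ge0/=.
apply: (@le_trans _ _ (p t + p (- t))); first by rewrite lerDl.
rewrite SE mulr_suml ler_sum// => i _.
apply: le_trans (ler_norm _) _; rewrite !normrM gtr0_norm// -[leRHS]mulrA.
rewrite ler_wpM2l ?mulr_ge0// -exprMn distrC.
by have /andP[c0 c1] := le_oneB_cos (w i * t); rewrite ger0_norm.
Qed.

Lemma is_derive_trig_sum (I : finType) (x y w : I -> R) :
  is_derive (0:R) 1
    (fun t => \sum_i (x i * cos (w i * t) - y i * sin (w i * t)))
    (- \sum_i y i * w i).
Proof.
have dw (a : R) : is_derive (0:R) 1 ( *%R a) a.
  have -> : *%R a = a \*: (@id R) by apply/funext.
  by apply: is_derive_eq; rewrite /GRing.scale /= mulr1.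
have dcos a : is_derive (0:R) 1 (@cos R \o ( *%R a)) (- sin (a * 0) * a).
  exact: is_derive1_comp.
have dsin a : is_derive (0:R) 1 (@sin R \o ( *%R a)) (cos (a * 0) * a).
  exact: is_derive1_comp.
have -> : (fun t => \sum_i (x i * cos (w i * t) - y i * sin (w i * t))) =
    \sum_i ((x i \*: (@cos R \o ( *%R (w i)))) -
     (y i \*: (@sin R \o ( *%R (w i))))).
  by apply/funext => t; rewrite fct_sumE.
rewrite -sumrN; elim/big_ind2 : _ => [|f df g dg Df Dg|i _].
- exact: is_derive_cst.
- exact: is_deriveD.
- by apply: is_derive_eq; rewrite !mulr0 cos0 sin0 /GRing.scale /=; ring.
Qed.

Lemma Re_evolve_diagE n (H rho : 'M[C]_n) t i (z := spectral_weight H rho i) :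
  Re (evolve H t rho i i) =
  \sum_ab (Re (z ab) * cos (spectral_gap H ab * t)
           - Im (z ab) * sin (spectral_gap H ab * t)).
Proof.
by rewrite evolve_diagE Re_sum; apply: eq_bigr => ab _; rewrite Re_mul.
Qed.

(** A nonnegative trigonometric polynomial that vanishes at 0 has a minimum there, so it vanishes to
    second order. This is the bound that [is_derive_eta2_0] asks for. *)
Lemma evolve_diag_bound n (H rho : 'M[C]_n) i : density rho ->
  Re (evolve H 0 rho i i) = 0 ->
  exists B, forall t, 0 <= Re (evolve H t rho i i) <= B * t ^+ 2.
Proof.
move=> drho; apply: trig_sum_bound => t; first exact: Re_evolve_diagE.
exact: evolve_diag_ge0.
Qed.

(** The derivative of $e^{-iHt}\rho e^{iHt}$ at 0 is $-i[H,\rho]$, and $\mathrm{Re}(-iz) =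
    \mathrm{Im}\,z$. The identity is checked by expanding the commutator in the eigenbasis of
    $H$. *)
Lemma is_derive_evolve_diag n (H rho : 'M[C]_n) i : is_hermitian H ->
  is_derive (0:R) 1 (fun t => Re (evolve H t rho i i))
    (Im ((H *m rho) i i - (rho *m H) i i)).
Proof.
move=> hH.
rewrite (funext (fun t => Re_evolve_diagE H rho t i)).
have := is_derive_trig_sum (Re \o spectral_weight H rho i)
  (Im \o spectral_weight H rho i) (spectral_gap H).
move=> /is_derive_eq; apply.
have -> : (H *m rho) i i - (rho *m H) i i =
    \sum_ab spectral_weight H rho i ab * (- (spectral_gap H ab)%:C%C).
  rewrite {1 2}(hermitian_spectral hH).
  set P := spectralmx H; set l := spectral_diag H.
  (* Inserting the identity as a second diagonal factor brings both products to the form of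
     [mulmx_diag_conjE]; their weights differ by $\lambda_a - \lambda_b$. *)
  have -> : invmx P *m diag_mx l *m P *m rho =
     invmx P *m (diag_mx l *m (P *m rho *m invmx P) *m diag_mx (const_mx 1)) *m P.
    by rewrite diag_const_mx mulmx1 !mulmxA (mulmxKV (spectral_unit H)).
  have -> : rho *m (invmx P *m diag_mx l *m P) =
     invmx P *m (diag_mx (const_mx 1) *m (P *m rho *m invmx P) *m diag_mx l) *m P.
    by rewrite diag_const_mx mul1mx !mulmxA (mulVmx (spectral_unit H)) mul1mx.
  rewrite (mulmx_diag_conjE _ _ _ l) (mulmx_diag_conjE _ _ _ (const_mx 1)) -sumrB.
  apply: eq_bigr => -[a b] _ /=.
  rewrite /spectral_weight /spectral_gap /= -/P -/l !(mxE _ (fun _ _ => 1)).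
  rewrite (hermitian_spectral_Re a hH) (hermitian_spectral_Re b hH) -/l.
  by rewrite rmorphB /=; ring.
rewrite Im_sum -sumrN; apply: eq_bigr => ab _.
by rewrite Im_mul /= oppr0 mulr0 add0r mulrN.
Qed.

End Quantum.

(** * The rate of coherence generation *)

Section Rate.
Variable R : realType.
Local Notation C := (R[i]).
Local Notation Re := (@complex.Re R).
Local Notation Im := (@complex.Im R).

(** * Constraints that positivity puts on the entries of a state *)

(** The squared modulus as an element of [R], whereas the norm of [R[i]] is complex-valued. *)
Definition sqnorm (z : C) : R := Re z ^+ 2 + Im z ^+ 2.

Lemma sqnorm_ge0 z : 0 <= sqnorm z.
Proof. by rewrite addr_ge0 ?sqr_ge0. Qed.

Lemma density_diag_ge0 n (rho : 'M[C]_n) i : density rho -> 0 <= Re (rho i i).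
Proof.
case=> _ rho_ge0 _; have := rho_ge0 (delta_mx i 0).
have -> : adjmx (delta_mx i 0 : 'cV[C]_n) = delta_mx 0 i.
  by apply/matrixP => k l; rewrite adjmxE !mxE conjc_nat andbC.
by rewrite -rowE -colE !mxE lecE => /andP[].
Qed.


(** The form of [rho] is tested on $x e_i - y\rho_{ji} e_j$ with real $x, y$. This phase makes the
    cross terms real, which leaves a real quadratic form in $x, y$ to be evaluated at well-chosen
    points. *)
Lemma density_minor n (rho : 'M[C]_n) i j : density rho ->
  sqnorm (rho i j) <= Re (rho i i) * Re (rho j j).
Proof.
move=> drho; have [/is_hermitianP hr rho_ge0 _] := drho.
have form (a b : C) : 0 <= conjc a * a * rho i i + conjc a * b * rho i j +
    conjc b * a * rho j i + conjc b * b * rho j j.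
  have := rho_ge0 (a *: delta_mx i 0 + b *: delta_mx j 0).
  have -> : adjmx (a *: delta_mx i 0 + b *: delta_mx j 0 : 'cV_n) =
      conjc a *: delta_mx 0 i + conjc b *: delta_mx 0 j.
    apply/matrixP => k l; rewrite adjmxE !mxE rmorphD !rmorphM /=.
    by rewrite !conjc_nat andbC [in X in _ + X]andbC.
  rewrite mulmxDl mulmxDr !mulmxDl -!scalemxAl -!scalemxAr -!rowE -!colE.
  by rewrite !mxE; congr (0 <= _); ring.
have quad (x y : R) : 0 <= x ^+ 2 * Re (rho i i) - 2 * x * y * sqnorm (rho i j)
    + y ^+ 2 * sqnorm (rho i j) * Re (rho j j).
  have := form x%:C%C (- y%:C%C * rho j i); rewrite lecE => /andP[_].
  have := hr i i; have := hr j j; rewrite (hr j i) /sqnorm.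
  case: (rho i i) => a1 a2; case: (rho j j) => b1 b2; case: (rho i j) => c1 c2.
  move=> [b20] [a20] /=.
  have -> : a2 = 0 by lra.
  have -> : b2 = 0 by lra.
  by congr (0 <= _); ring.
have := density_diag_ge0 i drho; have := density_diag_ge0 j drho.
have := sqnorm_ge0 (rho i j); move: (sqnorm _) quad => m quad m0.
move: (Re (rho i i)) (Re (rho j j)) quad => p q quad.
rewrite le_eqVlt => /orP[/eqP q0|q0] p0.
  (* For $q = 0$ this choice gives $-m^2(p + 2) \ge 0$, so $m = 0$. *)
  have := quad m (p + 1); rewrite -q0 !mulr0 addr0; nra.
have := quad q 1; rewrite (_ : _ + _ = q * (p * q - m)); last by ring.
by rewrite pmulr_rge0// subr_ge0.
Qed.

Lemma CauchySchwarz_sum (I : finType) (a b : I -> R) :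
  \sum_i a i * b i <= Num.sqrt (\sum_i a i ^+ 2) * Num.sqrt (\sum_i b i ^+ 2).
Proof.
set A := \sum_i a i ^+ 2; set B := \sum_i b i ^+ 2; set S := \sum_i _.
have A0 : 0 <= A by rewrite sumr_ge0// => i _; exact: sqr_ge0.
have B0 : 0 <= B by rewrite sumr_ge0// => i _; exact: sqr_ge0.
rewrite -sqrtrM//; apply: le_trans (ler_norm _) _; rewrite -sqrtr_sqr ler_wsqrtr//.
have [Bp|Bn] := ltP 0 B; last first.
  have B00 : B = 0 by apply/eqP; rewrite eq_le Bn.
  have b0 i : b i = 0.
    have /eqP := B00; rewrite psumr_eq0; last by move=> ? _; exact: sqr_ge0.
    by move=> /allP/(_ i (mem_index_enum i)) /=; rewrite sqrf_eq0 => /eqP.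
  rewrite B00 mulr0 /S big1 ?expr0n// => i _; by rewrite b0 mulr0.
have : 0 <= \sum_i (B * a i - S * b i) ^+ 2.
  by rewrite sumr_ge0// => i _; exact: sqr_ge0.
have -> : \sum_i (B * a i - S * b i) ^+ 2 = B * (A * B - S ^+ 2).
  transitivity (\sum_i (B ^+ 2 * a i ^+ 2 - 2 * B * S * (a i * b i)
      + S ^+ 2 * b i ^+ 2)).
    by apply: eq_bigr => i _; ring.
  rewrite big_split sumrB -!mulr_sumr -/A -/B -/S /=; ring.
by rewrite pmulr_rge0// subr_ge0.
Qed.

Lemma density_diag_sum n (rho : 'M[C]_n) : density rho -> \sum_i Re (rho i i) = 1.
Proof. by case=> _ _; rewrite /mxtrace => /(congr1 Re); rewrite Re_sum. Qed.

Lemma density_prob_dist n (rho : 'M[C]_n) : density rho ->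
  prob_dist (fun i => Re (rho i i)).
Proof.
by move=> drho; split; [move=> i; exact: density_diag_ge0|exact: density_diag_sum].
Qed.

Lemma density_diag_le1 n (rho : 'M[C]_n) i : density rho -> Re (rho i i) <= 1.
Proof.
move=> drho; rewrite -(density_diag_sum drho) (bigD1 i)//= lerDl.
by rewrite sumr_ge0// => j _; exact: density_diag_ge0.
Qed.

(** The minor inequality together with $\rho_{jj} \le 1$. It supplies the domination by
    $\sqrt{\rho_{ii}}$ under which [cvg_lnM] controls $\ln \rho_{ii}$ times an entry. *)
Lemma density_entry_le n (rho : 'M[C]_n) i j : density rho ->
  `|Re (rho i j)| <= Num.sqrt (Re (rho i i)) /\
  `|Im (rho i j)| <= Num.sqrt (Re (rho i i)).
Proof.
move=> drho; have m := density_minor i j drho.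
have p0 := density_diag_ge0 i drho; have p1 := density_diag_le1 j drho.
have {}m : sqnorm (rho i j) <= Re (rho i i).
  by apply: le_trans m _; rewrite ler_piMr.
rewrite -!sqrtr_sqr !ler_wsqrtr//; apply: le_trans m.
  by rewrite /sqnorm lerDr sqr_ge0.
by rewrite /sqnorm lerDl sqr_ge0.
Qed.

(** * The rate in closed form *)

(** Since [ln 0] is 0, an index with $\rho_{ii} = 0$ contributes nothing. *)
Definition rate_formula n (H rho : 'M[C]_n) : R :=
  - \sum_i log2 (Re (rho i i)) * Im ((H *m rho) i i - (rho *m H) i i).

Lemma propagator0 n (H : 'M[C]_n) : propagator H 0 = 1%:M.
Proof.
rewrite /propagator /mxfun (_ : map_mx _ _ = const_mx 1); last first.
  by apply/rowP => j; rewrite !mxE mulr0 /expiC cos0 sin0.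
by rewrite diag_const_mx mulmx1 mulVmx// spectral_unit.
Qed.

Lemma evolve0 n (H rho : 'M[C]_n) : evolve H 0 rho = rho.
Proof. by rewrite evolveE oppr0 propagator0 mul1mx mulmx1. Qed.

Lemma density_row0 n (rho : 'M[C]_n) i j : density rho ->
  Re (rho i i) = 0 -> rho i j = 0 /\ rho j i = 0.
Proof.
move=> drho p0; have [/is_hermitianP hr _ _] := drho.
have [r1 r2] := density_entry_le i j drho.
have r0 : rho i j = 0.
  move: r1 r2; rewrite p0 sqrtr0 !normr_le0; case: (rho i j) => x y /=.
  by move=> /eqP-> /eqP->.
by rewrite r0 (hr j i) r0 conjc0.
Qed.

(** For $\rho_{ii} > 0$ this is the chain rule. For $\rho_{ii} = 0$ row and column [i] of [rho]
    vanish, so the formula gives 0, in agreement with [is_derive_eta2_0]. *)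
Lemma is_derive_eta2_evolve n (H rho : 'M[C]_n) i :
  is_hermitian H -> density rho ->
  is_derive (0:R) 1 (fun t => eta2 (Re (evolve H t rho i i)))
   (- ((log2 (Re (rho i i)) + (ln 2)^-1) * Im ((H *m rho) i i - (rho *m H) i i))).
Proof.
move=> hH drho.
have Dp := is_derive_evolve_diag rho i hH.
have e0 : Re (evolve H 0 rho i i) = Re (rho i i) by rewrite evolve0.
have := density_diag_ge0 i drho; rewrite le_eqVlt => /orP[/eqP p0|p0].
  have [B HB] := evolve_diag_bound drho (etrans e0 (esym p0)).
  have := is_derive_eta2_0 HB; move=> /is_derive_eq; apply.
  rewrite !mxE !big1 ?subrr ?mulr0 ?oppr0// => k _;
    by have [r1 r2] := density_row0 k drho (esym p0); rewrite ?r1 ?r2 ?mulr0 ?mul0r.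
have D_eta2 (q : R -> R) dq x : is_derive (0:R) 1 q dq -> q 0 = x -> 0 < x ->
    is_derive (0:R) 1 (fun t => eta2 (q t)) (- ((log2 x + (ln 2)^-1) * dq)).
  by move=> Dq <-; exact: is_derive_eta2.
exact: (D_eta2 _ _ _ Dp e0 p0).
Qed.

(** The derivatives of the diagonal entropies are summed; the constants $1/\ln 2$ multiply the trace
    of $[H,\rho]$, which is zero. *)
Lemma coh_rateE n (H rho : 'M[C]_n) : is_hermitian H -> density rho ->
  coh_rate H rho = rate_formula H rho.
Proof.
move=> hH drho; have [hr _ _] := drho.
pose D i := - ((log2 (Re (rho i i)) + (ln 2)^-1) *
  Im ((H *m rho) i i - (rho *m H) i i)).
have Ds : is_derive (0:R) 1 (fun t => Crel (evolve H t rho)) (\sum_i D i).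
  rewrite (funext (fun t => CrelE H t hr)).
  have -> : (fun t => \sum_i eta2 (Re (evolve H t rho i i)) - vN_entropy rho) =
      \sum_i (fun t => eta2 (Re (evolve H t rho i i))) + cst (- vN_entropy rho).
    by apply/funext => t; rewrite fct_sumE.
  rewrite -[X in is_derive _ _ _ X]addr0; apply: is_deriveD.
  by apply: is_derive_sum => i; exact: is_derive_eta2_evolve.
rewrite /coh_rate derive1E (@derive_val _ _ _ _ _ _ _ Ds) /D /rate_formula.
rewrite sumrN; congr (- _).
under eq_bigr do rewrite mulrDl.
rewrite big_split -mulr_sumr -Im_sum sumrB /=.
by rewrite -!/(mxtrace _) mxtrace_mulC subrr mulr0 addr0.
Qed.

(** With $T_{ij} = \mathrm{Im}(H_{ij}\rho_{ji})$, the imaginary part of $[H,\rho]_{ii}$ is $\sum_j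
    (T_{ij} - T_{ji})$; exchanging the names of $i$ and $j$ in the second half moves the difference
    onto the logarithms. *)
Lemma rate_formulaE n (H rho : 'M[C]_n) :
  rate_formula H rho =
  - \sum_(ij : 'I_n * 'I_n) (log2 (Re (rho ij.1 ij.1)) - log2 (Re (rho ij.2 ij.2)))
     * Im (H ij.1 ij.2 * rho ij.2 ij.1).
Proof.
rewrite /rate_formula; congr (- _).
pose L i := log2 (Re (rho i i)); pose T i j := Im (H i j * rho j i).
rewrite -(pair_bigA _ (fun i j => (L i - L j) * T i j)) /=.
under [RHS]eq_bigr do under eq_bigr do rewrite mulrBl.
under [RHS]eq_bigr do rewrite sumrB.
rewrite sumrB [X in _ = _ - X]exchange_big -sumrB /=.
apply: eq_bigr => i _; rewrite -!mulr_sumr -mulrBr; congr (_ * _).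
rewrite Im_sub !mxE !Im_sum; congr (_ - _).
by apply: eq_bigr => j _; rewrite mulrC.
Qed.

(** * The variance of the surprisal and the upper bound *)

(** The mean squared difference of two independent copies of a random variable is twice its
    variance; here the variable is the surprisal. *)
Lemma variance_pairs n (p : 'I_n -> R) : prob_dist p ->
  \sum_(ij : 'I_n * 'I_n) (log2 (p ij.1) - log2 (p ij.2)) ^+ 2 * (p ij.1 * p ij.2)
  = 2 * fsurp p.
Proof.
move=> [_ p1]; rewrite -(pair_bigA _ (fun i j => (log2 (p i) - log2 (p j)) ^+ 2 *
  (p i * p j))) /=.
rewrite /fsurp; under [in RHS]eq_bigr do rewrite sq_termE.
rewrite [X in _ - X ^+ 2](_ : _ = - \sum_i p i * log2 (p i)); last first.
  by rewrite -sumrN; apply: eq_bigr => i _; rewrite eta2E.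
set A := \sum_i _ * _ ^+ 2; set B := \sum_i _ * log2 _.
transitivity (\sum_i (p i * log2 (p i) ^+ 2 - 2 * B * (p i * log2 (p i)) + A * p i)).
  apply: eq_bigr => i _.
  transitivity (\sum_j (p i * log2 (p i) ^+ 2 * p j
    - 2 * (p i * log2 (p i)) * (p j * log2 (p j)) + p i * (p j * log2 (p j) ^+ 2))).
    by apply: eq_bigr => j _; ring.
  by rewrite big_split sumrB -!mulr_sumr p1 -/A -/B /=; ring.
by rewrite big_split sumrB -!mulr_sumr p1 -/A -/B /=; ring.
Qed.

Lemma fsurp_ge0 n (p : 'I_n -> R) : prob_dist p -> 0 <= fsurp p.
Proof.
move=> pp; rewrite -(pmulr_rge0 _ (ltr0n R 2)) -variance_pairs//.
case: pp => p0 _; apply: sumr_ge0 => ij _.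
by rewrite mulr_ge0 ?sqr_ge0 ?mulr_ge0.
Qed.

Lemma hs_normE n (H : 'M[C]_n) :
  hs_norm H = Num.sqrt (\sum_(ij : 'I_n * 'I_n) sqnorm (H ij.1 ij.2)).
Proof.
rewrite /hs_norm /mxtrace Re_sum; congr Num.sqrt.
rewrite -(pair_bigA _ (fun i j => sqnorm (H i j))) exchange_big /=.
apply: eq_bigr => i _; rewrite mxE Re_sum; apply: eq_bigr => j _.
by rewrite adjmxE Re_mul /sqnorm; case: (H j i) => a b /=; ring.
Qed.

Lemma rate_formula_le n (H rho : 'M[C]_n) : density rho ->
  rate_formula H rho <=
  hs_norm H * Num.sqrt (2 * fsurp (fun i => Re (rho i i))).
Proof.
move=> drho; rewrite rate_formulaE hs_normE -sumrN.
rewrite -(variance_pairs (density_prob_dist drho)).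
set L := fun i => log2 (Re (rho i i)).
pose a (ij : 'I_n * 'I_n) := Num.sqrt (sqnorm (H ij.1 ij.2)).
pose b (ij : 'I_n * 'I_n) := `|L ij.1 - L ij.2| * Num.sqrt (sqnorm (rho ij.2 ij.1)).
apply: (@le_trans _ _ (\sum_ij a ij * b ij)).
  apply: ler_sum => -[i j] _; rewrite /a /b /= -/(L i) -/(L j).
  apply: le_trans (ler_norm _) _; rewrite normrN normrM mulrCA ler_wpM2l//.
  rewrite -sqrtrM ?sqnorm_ge0// -sqrtr_sqr ler_wsqrtr// Im_mul /sqnorm.
  case: (H i j) (rho j i) => [x y] [u v] /=.
  (* $|z|^2 - (\mathrm{Im}\,z)^2 = (\mathrm{Re}\,z)^2$ for $z = H_{ij}\rho_{ji}$. *)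
  rewrite -subr_ge0 (_ : _ - _ = (x * u - y * v) ^+ 2) ?sqr_ge0//; ring.
apply: le_trans (CauchySchwarz_sum a b) _.
rewrite (eq_bigr (fun ij => sqnorm (H ij.1 ij.2))); last first.
  by move=> ij _; rewrite /a sqr_sqrtr// sqnorm_ge0.
rewrite ler_wpM2l ?sqrtr_ge0// ler_wsqrtr// ler_sum// => -[i j] _ /=.
rewrite /b exprMn real_normK ?num_real// sqr_sqrtr ?sqnorm_ge0//=.
by rewrite ler_wpM2l ?sqr_ge0// mulrC density_minor.
Qed.

End Rate.

(** * Maximizers *)

Section Extrema.
Variable R : realType.
Local Notation C := (R[i]).
Local Notation Re := (@complex.Re R).
Local Notation Im := (@complex.Im R).

Lemma closed_eq_cst (T : topologicalType) (f : T -> R) (a : R) :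
  continuous f -> closed [set z | f z = a].
Proof.
by move=> cf; apply: (@closed_comp _ _ f [set a]) => //; exact: closed_eq.
Qed.

Lemma closed_ge0 (T : topologicalType) (f : T -> R) :
  continuous f -> closed [set z | 0 <= f z].
Proof.
by move=> cf; apply: (@closed_comp _ _ f [set x | 0 <= x]) => //; exact: closed_ge.
Qed.

Lemma cvg_sum (T : Type) (F : set_system T) (FF : Filter F) (I : finType)
    (f : I -> T -> R) (l : I -> R) :
  (forall i, f i @ F --> l i) -> (fun z => \sum_i f i z) @ F --> \sum_i l i.
Proof. by move=> cf; apply: cvg_big => //; exact: add_continuous. Qed.

Lemma continuous_sum (T : topologicalType) (I : finType) (f : I -> T -> R) :
  (forall i, continuous (f i)) -> continuous (fun z => \sum_i f i z).
Proof. by move=> cf z; apply: cvg_sum => i; exact: cf. Qed.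

Lemma continuous_comp_fun (T : topologicalType) (g : R -> R) (f : T -> R) :
  continuous g -> continuous f -> continuous (fun z => g (f z)).
Proof. by move=> cg cf z; apply: (@continuous_cvg _ _ _ _ _ f g); [exact: cg|exact: cf]. Qed.

Lemma continuous_add_fun (T : topologicalType) (f g : T -> R) :
  continuous f -> continuous g -> continuous (fun z => f z + g z).
Proof. by move=> cf cg z; apply: cvgD; [exact: cf|exact: cg]. Qed.

Lemma continuous_opp_fun (T : topologicalType) (f : T -> R) :
  continuous f -> continuous (fun z => - f z).
Proof. by move=> cf z; apply: cvgN; exact: cf. Qed.

Lemma fsurp_max n : (0 < n)%N ->
  exists2 p : 'I_n -> R, prob_dist p &
    forall q : 'I_n -> R, prob_dist q -> fsurp q <= fsurp p.
Proof.
case: n => // n _.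
pose K : set {ptws 'I_n.+1 -> R} := [set p | prob_dist p].
(* [g] rewrites [fsurp] through [sqrt_ln]: it agrees with it on distributions and is visibly
   continuous on the whole function space. *)
pose g (p : {ptws 'I_n.+1 -> R}) : R := \sum_i (sqrt_ln (p i) / ln 2) ^+ 2 -
   (\sum_i - (Num.sqrt (p i) * (sqrt_ln (p i) / ln 2))) ^+ 2.
have gE p : prob_dist p -> fsurp p = g p.
  move=> [p0 _]; rewrite /fsurp /g; congr (_ - _ ^+ 2); apply: eq_bigr => i _.
    by rewrite sq_termE /log2 /sqrt_ln -{1}(sqr_sqrtr (p0 i)); ring.
  by rewrite eta2E /log2 /sqrt_ln -{1}(sqr_sqrtr (p0 i)); ring.
have c1 : continuous (fun x : R => (sqrt_ln x / ln 2) ^+ 2).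
  move=> x; apply: (@continuous_cvg _ _ _ _ _ _ (fun x : R => x ^+ 2)).
    exact: exprn_continuous.
  by apply: cvgMl; exact: continuous_sqrt_ln.
have c2 : continuous (fun x : R => - (Num.sqrt x * (sqrt_ln x / ln 2))).
  move=> x; apply: cvgN; apply: cvgM; first exact: sqrt_continuous.
  by apply: cvgMl; exact: continuous_sqrt_ln.
have pc (i : 'I_n.+1) := @ptws_proj_continuous R _ i.
have cg : continuous g.
  apply: continuous_add_fun.
    by apply: continuous_sum => i; apply: (continuous_comp_fun c1); exact: pc.
  apply: continuous_opp_fun.
  apply: (@continuous_comp_fun _ (fun x : R => x ^+ 2)); first exact: exprn_continuous.
  by apply: continuous_sum => i; apply: (continuous_comp_fun c2); exact: pc.
have clK : closed K.
  have -> : K = (\bigcap_i [set p : {ptws 'I_n.+1 -> R} | 0 <= p i])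
      `&` [set p : {ptws 'I_n.+1 -> R} | \sum_i p i = 1].
    apply/seteqP; split => p /=.
      by move=> [p0 p1]; split => // i _; exact: p0.
    by move=> [p0 p1]; split => // i; exact: p0.
  apply: closedI.
    by apply: closed_bigI => i _; apply: closed_ge0; exact: ptws_proj_continuous.
  apply: closed_eq_cst; apply: continuous_sum => i; exact: ptws_proj_continuous.
have K0 : K !=set0.
  exists (fun i => (i == ord0)%:R); split => [i|]; first exact: ler0n.
  by rewrite (bigD1 ord0)//= big1 ?addr0// => i /negPf ->.
have Kb p : K p -> forall i, `|p i| <= 1.
  move=> [p0 p1] i; rewrite ger0_norm// -p1 (bigD1 i)//= lerDl.
  by rewrite sumr_ge0.
have [p Kp pmax] := ptws_EVT_max K0 clK Kb (continuous_subspaceT cg).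
by exists p => // q Kq; rewrite !gE//; exact: pmax.
Qed.

(** * Maximizing the rate over states for a fixed Hamiltonian *)

Definition continuousC (T : topologicalType) (f : T -> C) :=
  continuous (Re \o f) /\ continuous (Im \o f).

Lemma continuousC_cst (T : topologicalType) (c : C) : continuousC (fun _ : T => c).
Proof. by split => z; exact: cvg_cst. Qed.

Lemma continuousCM (T : topologicalType) (f g : T -> C) :
  continuousC f -> continuousC g -> continuousC (fun z => f z * g z).
Proof.
move=> [f1 f2] [g1 g2]; split.
  rewrite (_ : _ \o _ = fun z => Re (f z) * Re (g z) - Im (f z) * Im (g z)).
    move=> z; apply: cvgB; apply: cvgM; [exact: f1|exact: g1|exact: f2|exact: g2].
  by apply/funext => z /=; rewrite Re_mul.
rewrite (_ : _ \o _ = fun z => Re (f z) * Im (g z) + Im (f z) * Re (g z)).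
  move=> z; apply: cvgD; apply: cvgM; [exact: f1|exact: g2|exact: f2|exact: g1].
by apply/funext => z /=; rewrite Im_mul.
Qed.

Lemma continuousC_sum (T : topologicalType) (I : finType) (f : I -> T -> C) :
  (forall i, continuousC (f i)) -> continuousC (fun z => \sum_i f i z).
Proof.
move=> cf; split.
  rewrite (_ : _ \o _ = fun z => \sum_i Re (f i z)).
    by apply: continuous_sum => i; have [] := cf i.
  by apply/funext => z /=; rewrite Re_sum.
rewrite (_ : _ \o _ = fun z => \sum_i Im (f i z)).
  by apply: continuous_sum => i; have [] := cf i.
by apply/funext => z /=; rewrite Im_sum.
Qed.

Lemma continuousC_quad (T : topologicalType) n (f : T -> 'M[C]_n) (v : 'cV[C]_n) :
  (forall i j, continuousC (fun z => f z i j)) ->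
  continuousC (fun z => (adjmx v *m f z *m v) 0 0).
Proof.
move=> cf.
rewrite (_ : (fun z => _) =
    fun z => \sum_j (\sum_i adjmx v 0 i * f z i j) * v j 0); last first.
  by apply/funext => z; rewrite mxE; apply: eq_bigr => j _; rewrite mxE.
apply: continuousC_sum => j; apply: continuousCM; last exact: continuousC_cst.
apply: continuousC_sum => i; apply: continuousCM; first exact: continuousC_cst.
exact: cf.
Qed.

(** Real coordinates for complex matrices, [true] marking real parts, so that [ptws_EVT_max] applies
    to sets of states. *)
Definition mx_of_coord n (z : bool * ('I_n * 'I_n) -> R) : 'M[C]_n :=
  \matrix_(i, j) Complex (z (true, (i, j))) (z (false, (i, j))).

(** Every clause of [density] is a family of equalities or weak inequalities between continuous real
    functions of the coordinates. Positivity gives two conditions for each vector [v], because $0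
    \le z$ in [R[i]] means that $z$ is real and has nonnegative real part. *)
Lemma closed_density n :
  closed [set z : {ptws bool * ('I_n * 'I_n) -> R} | density (mx_of_coord z)].
Proof.
pose Z := {ptws bool * ('I_n * 'I_n) -> R}.
have pc k : continuous (fun z : Z => z k) by exact: ptws_proj_continuous.
have cm i j : continuousC (fun z : Z => mx_of_coord z i j).
  split; [rewrite (_ : _ \o _ = fun z : Z => z (true, (i, j)))|
          rewrite (_ : _ \o _ = fun z : Z => z (false, (i, j)))] => //;
    by apply/funext => z /=; rewrite mxE.
have cq v := continuousC_quad v cm.
have -> : [set z : Z | density (mx_of_coord z)] =
  (\bigcap_ij [set z : Z | z (true, ij) - z (true, (ij.2, ij.1)) = 0]) `&`
  (\bigcap_ij [set z : Z | z (false, ij) + z (false, (ij.2, ij.1)) = 0]) `&`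
  (\bigcap_(v : 'cV[C]_n)
    [set z : Z | Im ((adjmx v *m mx_of_coord z *m v) 0 0) = 0]) `&`
  (\bigcap_(v : 'cV[C]_n)
    [set z : Z | 0 <= Re ((adjmx v *m mx_of_coord z *m v) 0 0)]) `&`
  [set z : Z | Re (\sum_i mx_of_coord z i i) = 1] `&`
  [set z : Z | Im (\sum_i mx_of_coord z i i) = 0].
  apply/seteqP; split => z.
    move=> [/is_hermitianP hz z0 z1]; rewrite -!/(mxtrace _).
    split; [split; [split; [split; [split|]|]|]|] => /=.
    - by move=> [i j] _ /=; have := hz i j; rewrite !mxE => -[-> _]; rewrite subrr.
    - by move=> [i j] _ /=; have := hz i j; rewrite !mxE => -[_ ->]; rewrite addNr.
    - by move=> v _ /=; have := z0 v; rewrite lecE => /andP[/eqP].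
    - by move=> v _ /=; have := z0 v; rewrite lecE => /andP[].
    - by rewrite -/(mxtrace _) z1.
    - by rewrite -/(mxtrace _) z1.
  move=> [[[[[h1 h2] h3] h4] h5] h6]; split.
  - apply/is_hermitianP => i j; rewrite !mxE /=.
    have /= /eqP := h1 (i, j) I; rewrite subr_eq0 => /eqP ->.
    by have /= /eqP := h2 (i, j) I; rewrite addr_eq0 => /eqP ->.
  - by move=> v; rewrite lecE (h3 v I) (h4 v I) /= eqxx.
  - rewrite /mxtrace; move: h5 h6 => /=; case: (\sum_i _) => a b /= -> -> //.
have cs : continuousC (fun z : Z => \sum_i mx_of_coord z i i).
  exact: continuousC_sum.
apply: closedI; last by apply: closed_eq_cst; case: cs.
apply: closedI; last by apply: closed_eq_cst; case: cs.
apply: closedI; last first.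
  by apply: closed_bigI => v _; apply: closed_ge0; case: (cq v).
apply: closedI; last first.
  by apply: closed_bigI => v _; apply: closed_eq_cst; case: (cq v).
apply: closedI.
  apply: closed_bigI => ij _; apply: closed_eq_cst.
  by apply: continuous_add_fun; [|apply: continuous_opp_fun]; exact: pc.
apply: closed_bigI => ij _; apply: closed_eq_cst.
by apply: continuous_add_fun; exact: pc.
Qed.

(** The states form a compact set, on which the rate is continuous even where a population vanishes.
    Continuity is claimed only within this set, since it rests on the bounds that positivity puts on
    the entries; [rho0] makes the set nonempty. *)
Lemma rate_formula_max n (H rho0 : 'M[C]_n) : density rho0 ->
  exists2 rho : 'M[C]_n, density rho &
    forall sigma : 'M[C]_n, density sigma -> rate_formula H sigma <= rate_formula H rho.
Proof.
move=> drho0.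
pose Z := {ptws bool * ('I_n * 'I_n) -> R}.
pose K : set Z := [set z : Z | density (mx_of_coord z)].
pose coord (rho : 'M[C]_n) : Z := fun k =>
  if k.1 then Re (rho k.2.1 k.2.2) else Im (rho k.2.1 k.2.2).
have coordK rho : mx_of_coord (coord rho) = rho.
  by apply/matrixP => i j; rewrite mxE /coord /=; case: (rho i j).
have K0 : K !=set0 by exists (coord rho0); rewrite /K /= coordK.
have Kb z : K z -> forall k, `|z k| <= 1.
  move=> Kz [b [i j]]; have [r1 r2] := density_entry_le i j Kz.
  have s1 : Num.sqrt (Re (mx_of_coord z i i)) <= 1.
    by rewrite -sqrtr1 ler_wsqrtr// density_diag_le1.
  by case: b; [move: r1|move: r2] => /le_trans/(_ s1); rewrite mxE.
have ReE (z : Z) i j : Re (mx_of_coord z i j) = z (true, (i, j)) by rewrite mxE.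
have ImE (z : Z) i j : Im (mx_of_coord z i j) = z (false, (i, j)) by rewrite mxE.
pose f (z : Z) := rate_formula H (mx_of_coord z).
have cf : {within K, continuous f}.
  apply/subspace_continuousP => z0 Kz0.
  pose F := within K (nbhs z0).
  have pc k : (fun z : Z => z k) @ F --> z0 k.
    by apply: cvg_within_filter; exact: ptws_proj_continuous.
  (* An entry in row [i] is at most $\sqrt{\rho_{ii}}$ in each part, and an entry in column [i]
     reduces to this case by hermiticity. *)
  have cl i b k l : k = i \/ l = i ->
      (fun z : Z => ln (z (true, (i, i))) * z (b, (k, l))) @ F -->
      ln (z0 (true, (i, i))) * z0 (b, (k, l)).
    move=> ikl; apply: cvg_lnM; [exact: pc|exact: pc|].
    near=> z; have Kz : K z by near: z; exact: withinT.
    have [hz _ _] := Kz; move: hz => /is_hermitianP hz.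
    rewrite -ReE; case: ikl => <-.
      have [r1 r2] := density_entry_le k l Kz.
      by case: b => //; rewrite -?ReE -?ImE.
    have [r1 r2] := density_entry_le l k Kz.
    case: b; rewrite -?ReE -?ImE hz; move: r1 r2; case: (mx_of_coord z l k) => x y //=.
    by rewrite normrN.
  (* The products are distributed so that each logarithm multiplies an entry from its own row or
     column, as [cl] requires. *)
  rewrite /f (_ : (fun z : Z => _) = fun z : Z =>
     - \sum_(ij : 'I_n * 'I_n) (ln 2)^-1 * (
        (Re (H ij.1 ij.2) * (ln (z (true, (ij.1, ij.1))) * z (false, (ij.2, ij.1))
                           - ln (z (true, (ij.2, ij.2))) * z (false, (ij.2, ij.1))))
      + (Im (H ij.1 ij.2) * (ln (z (true, (ij.1, ij.1))) * z (true, (ij.2, ij.1))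
                           - ln (z (true, (ij.2, ij.2))) * z (true, (ij.2, ij.1)))))); last first.
    apply/funext => z; rewrite rate_formulaE; congr (- _); apply: eq_bigr => ij _.
    by rewrite Im_mul !ReE ImE /log2; ring.
  apply: cvgN; apply: cvg_sum => -[i j] /=; apply: cvgMr; apply: cvgD;
    apply: cvgMr; apply: cvgB; apply: cl; by [left|right].
have [z Kz zmax] := ptws_EVT_max K0 (@closed_density n) Kb cf.
exists (mx_of_coord z) => // s ds; rewrite -(coordK s); apply: zmax.
by rewrite /K /= coordK.
Unshelve. all: by end_near. Qed.

(** * The state and the Hamiltonian that attain the bound *)

Definition pure_state n (p : 'I_n -> R) : 'M[C]_n :=
  \matrix_(i, j) (Num.sqrt (p i) * Num.sqrt (p j))%:C%C.

Lemma pure_state_diag n (p : 'I_n -> R) i : prob_dist p ->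
  pure_state p i i = (p i)%:C%C.
Proof. by move=> [p0 _]; rewrite mxE -expr2 sqr_sqrtr. Qed.

Lemma density_pure_state n (p : 'I_n -> R) : prob_dist p -> density (pure_state p).
Proof.
move=> pp; split.
- by apply/is_hermitianP => i j; rewrite !mxE conjc_real mulrC.
(* The quadratic form at [v] is $|\langle\psi, v\rangle|^2$. *)
- move=> v; pose psi : 'cV[C]_n := \col_i (Num.sqrt (p i))%:C%C.
  have -> : pure_state p = psi *m adjmx psi.
    apply/matrixP => i j; rewrite !mxE big_ord1 adjmxE !mxE conjc_real.
    by rewrite rmorphM.
  rewrite mulmxA -mulmxA.
  have -> : adjmx v *m psi = adjmx (adjmx psi *m v) by rewrite adjmxM adjmxK.
  by rewrite mxE big_ord1 adjmxE mulrC mulcJ_ge0.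
- rewrite /mxtrace; under eq_bigr do rewrite pure_state_diag//.
  by rewrite -rmorph_sum /=; case: pp => _ ->.
Qed.

(** Imaginary antisymmetric entries make it Hermitian, and their proportions give equality in
    Cauchy-Schwarz against [pure_state p]. The prefactor normalizes it to norm 1; when [fsurp p] is
    0, the inverse of 0 is 0 and the matrix is zero. *)
Definition optimal_hamiltonian n (p : 'I_n -> R) : 'M[C]_n :=
  \matrix_(i, j) Complex 0 ((Num.sqrt (2 * fsurp p))^-1 *
    (log2 (p j) - log2 (p i)) * (Num.sqrt (p i) * Num.sqrt (p j))).

Lemma optimal_hamiltonian_hermitian n (p : 'I_n -> R) :
  is_hermitian (optimal_hamiltonian p).
Proof.
apply/is_hermitianP => i j; rewrite !mxE /=.
by congr Complex; ring.
Qed.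

Lemma hs_norm_optimal n (p : 'I_n -> R) : prob_dist p ->
  hs_norm (optimal_hamiltonian p) <= 1.
Proof.
move=> pp; have [p0 _] := pp; have f0 : 0 <= 2 * fsurp p by rewrite mulr_ge0// fsurp_ge0.
rewrite hs_normE -sqrtr1 ler_wsqrtr//.
rewrite (eq_bigr (fun ij => (Num.sqrt (2 * fsurp p))^-1 ^+ 2 *
    ((log2 (p ij.1) - log2 (p ij.2)) ^+ 2 * (p ij.1 * p ij.2)))); last first.
  move=> [i j] _; rewrite /sqnorm mxE /=.
  have -> : p i * p j = (Num.sqrt (p i) * Num.sqrt (p j)) ^+ 2.
    by rewrite exprMn !sqr_sqrtr.
  by ring.
rewrite -mulr_sumr variance_pairs// exprVn sqr_sqrtr//.
by have [->|f1] := eqVneq (2 * fsurp p) 0; rewrite ?mulr0// mulVf.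
Qed.

Lemma rate_formula_optimal n (p : 'I_n -> R) : prob_dist p ->
  rate_formula (optimal_hamiltonian p) (pure_state p) = Num.sqrt (2 * fsurp p).
Proof.
move=> pp; have [p0 _] := pp; have f0 : 0 <= 2 * fsurp p by rewrite mulr_ge0// fsurp_ge0.
rewrite rate_formulaE -sumrN.
rewrite (eq_bigr (fun ij => (Num.sqrt (2 * fsurp p))^-1 *
    ((log2 (p ij.1) - log2 (p ij.2)) ^+ 2 * (p ij.1 * p ij.2)))); last first.
  move=> [i j] _; rewrite !pure_state_diag// Im_mul !mxE /=.
  have -> : p i * p j = (Num.sqrt (p i) * Num.sqrt (p j)) ^+ 2.
    by rewrite exprMn !sqr_sqrtr.
  by ring.
rewrite -mulr_sumr variance_pairs// -{2}(sqr_sqrtr f0).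
have [->|s0] := eqVneq (Num.sqrt (2 * fsurp p)) 0; first by rewrite expr0n mulr0.
by rewrite expr2 mulKf.
Qed.

End Extrema.

(** * Equality of the two maxima *)

Theorem theorem1 (R : realType) (d : nat) (hd : (2 <= d)%N) :
  exists v : R,
    (* v = max_p sqrt(2 f(p)) *)
    [/\ (exists2 p : 'I_d -> R, prob_dist p & Num.sqrt (2 * fsurp p) = v),
        (forall p : 'I_d -> R, prob_dist p -> Num.sqrt (2 * fsurp p) <= v),
    (* every admissible H has a well-defined C_gen(H), bounded by v *)
        (forall H : 'M[R[i]]_d, is_hermitian H -> hs_norm H <= 1 ->
           exists2 c : R, Cgen_is H c & c <= v)
    (* and v is attained: v = max_{||H||_2 <= 1} C_gen(H) *)
      & exists H : 'M[R[i]]_d, [/\ is_hermitian H, hs_norm H <= 1 & Cgen_is H v]].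
Proof.
have [p pp pmax] := fsurp_max R (ltnW hd).
have v_max (q : 'I_d -> R) : prob_dist q ->
    Num.sqrt (2 * fsurp q) <= Num.sqrt (2 * fsurp p).
  by move=> dq; rewrite ler_wsqrtr// ler_wpM2l// pmax.
have rate_le (H rho : 'M[R[i]]_d) : hs_norm H <= 1 -> density rho ->
    rate_formula H rho <= Num.sqrt (2 * fsurp p).
  move=> H1 drho; apply: le_trans (rate_formula_le H drho) _.
  apply: (@le_trans _ _ (1 * Num.sqrt (2 * fsurp (fun i => complex.Re (rho i i))))).
    by rewrite ler_wpM2r// sqrtr_ge0.
  by rewrite mul1r v_max//; exact: density_prob_dist.
exists (Num.sqrt (2 * fsurp p)); split => //; first by exists p.
- move=> H hH H1.
  (* Here the pure state serves only to show that states exist. *)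
  have [rho drho rho_max] := rate_formula_max H (density_pure_state pp).
  exists (rate_formula H rho); last exact: rate_le.
  split=> [|s ds]; first by exists rho; rewrite ?coh_rateE.
  by rewrite coh_rateE// rho_max.
- have hH := optimal_hamiltonian_hermitian p; have H1 := hs_norm_optimal pp.
  have dp := density_pure_state pp.
  (* The pure state reaches the value, and the bound [rate_le], uniform in [H] and [rho], shows that
     no other state exceeds it. *)
  exists (optimal_hamiltonian p); split => //; split=> [|s ds].
    by exists (pure_state p); rewrite ?coh_rateE// rate_formula_optimal.
  by rewrite coh_rateE// rate_le.
Qed.
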